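(* Let $G$ be a finite, connected, undirected multigraph without loops, let $x\neq y$ be vertices, and let $k_{xy}$ be an integer with $\gcd(|\mathrm{Jac}(G)|,k_{xy})=1$. Let $G_1$ be the multigraph obtained from $G$ by deleting $k_{xy}$ of the edges between $x$ and $y$ if $k_{xy}\ge 0$ (assuming $G$ has at least $k_{xy}$ such edges), or by adding $|k_{xy}|$ edges between $x$ and $y$ if $k_{xy}<0$; assume $G_1$ is connected. Let $S$ be the subgroup of $\mathrm{Jac}(G)$ generated by $[\delta_{xy}]$ and $S_1$ the subgroup of $\mathrm{Jac}(G_1)$ generated by $[\delta_{xy}]$. Then $$\gcd(|\mathrm{Jac}(G)|,|\mathrm{Jac}(G_1)|)\ \Big|\ [\mathrm{Jac}(G):S]^2\quad\text{and}\quad \gcd(|\mathrm{Jac}(G)|,|\mathrm{Jac}(G_1)|)\ \Big|\ [\mathrm{Jac}(G_1):S_1]^2.$$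
   Context: For a finite connected loopless multigraph $H$ with vertex set $V(H)$: a divisor is an element of $\mathbb{Z}^{V(H)}$; its degree is the sum of its values; $\mathrm{Div}^0(H)$ is the group of degree-zero divisors. The Laplacian is $L=\Delta-A$, where $\Delta$ is the diagonal matrix of vertex valencies and $A_{vw}$ is the number of edges between $v$ and $w$. Principal divisors are those of the form $L\sigma$ with $\sigma\in\mathbb{Z}^{V(H)}$, and $\mathrm{Jac}(H)=\mathrm{Div}^0(H)/\{L\sigma\}$, a finite abelian group whose order equals the number of spanning trees of $H$. For vertices $x\neq y$, $\delta_{xy}$ is the divisor with value $-1$ at $x$, $1$ at $y$ and $0$ elsewhere, and $[\delta_{xy}]$ is its class in the Jacobian. *)

(* Defs.v *)
From HB Require Import structures.
From mathcomp Require Import all_boot all_order all_algebra.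
From mathcomp Require Import generic_quotient ring_quotient finmap.
From mathcomp Require Import boolp classical_sets cardinality.

Set Implicit Arguments.
Unset Strict Implicit.
Unset Printing Implicit Defensive.
Import GRing.Theory.
Local Open Scope ring_scope.

(* [mult G v w] is the number of edges between [v] and [w]. *)
Record multigraph (V : finType) := Multigraph {
  mult :> V -> V -> nat;
  mult_sym : forall v w, mult v w = mult w v;
  mult_loopless : forall v, mult v v = 0%N }.

Section Multigraph.
Variables (V : finType) (G : multigraph V).

Definition connected_graph : Prop :=
  forall v w : V, connect [rel u u' | (0 < G u u')%N] v w.

Definition valency (v : V) : nat := \sum_(w : V) G v w.

Definition laplacian (v w : V) : int :=
  (if v == w then (valency v)%:Z else 0) - (G v w)%:Z.

Definition laplacian_app (s : {ffun V -> int}) : {ffun V -> int} :=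
  [ffun v => \sum_(w : V) laplacian v w * s w].

Lemma laplacian_app_sub : {morph laplacian_app : s t / s - t}.
Proof.
move=> s t; apply/ffunP => v; rewrite !ffunE -sumrB.
by apply: eq_bigr => w _; rewrite !ffunE mulrBr.
Qed.

End Multigraph.

Section Divisors.
Variable V : finType.

Definition divisor := {ffun V -> int}.
HB.instance Definition _ := GRing.Zmodule.on divisor.

Definition degree (D : divisor) : int := \sum_(v : V) D v.

Definition degree0 : {pred divisor} := fun D => degree D == 0.

Lemma degree0_zmod_closed : zmod_closed degree0.
Proof.
split=> [|D E]; rewrite !unfold_in /degree.
  by rewrite big1 // => v _; rewrite ffunE.
move=> /eqP D0 /eqP E0.
under eq_bigr do rewrite !ffunE.
by rewrite sumrB D0 E0 subrr.
Qed.
HB.instance Definition _ :=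
  GRing.isZmodClosed.Build divisor degree0 degree0_zmod_closed.

Record Div0 := MkDiv0 { div0_val :> divisor; div0P : div0_val \in degree0 }.
HB.instance Definition _ := [isSub for div0_val].
HB.instance Definition _ := [Choice of Div0 by <:].
HB.instance Definition _ := [SubChoice_isSubZmodule of Div0 by <:].

Definition delta_div (x y : V) : divisor :=
  [ffun v => (v == y)%:R - (v == x)%:R].

Lemma delta_div_degree0 (x y : V) : delta_div x y \in degree0.
Proof.
have sum1 (z : V) : \sum_(v : V) (v == z)%:R = 1 :> int.
  by rewrite (bigD1 z) //= eqxx big1 ?addr0 // => v /negPf ->.
rewrite unfold_in /degree; under eq_bigr do rewrite ffunE.
by rewrite sumrB !sum1 subrr.
Qed.

Definition delta (x y : V) : Div0 := MkDiv0 (delta_div_degree0 x y).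

End Divisors.

Section Jacobian.
Variables (V : finType) (G : multigraph V).

Definition principal : {pred Div0 V} :=
  fun D => `[< exists s : divisor V, div0_val D = laplacian_app G s >].

Lemma principal_zmod_closed : zmod_closed principal.
Proof.
split=> [|D E]; rewrite !unfold_in.
  apply/asboolP; exists 0; apply/ffunP => v; rewrite !ffunE.
  by rewrite big1 // => w _; rewrite ffunE mulr0.
move=> /asboolP[s Ds] /asboolP[t Et]; apply/asboolP; exists (s - t).
by rewrite laplacian_app_sub -Ds -Et.
Qed.
HB.instance Definition _ :=
  GRing.isZmodClosed.Build (Div0 V) principal principal_zmod_closed.

Definition Jac := Quotient.quot principal.
HB.instance Definition _ := GRing.Zmodule.on Jac.

Definition div_class (D : Div0 V) : Jac := (\pi_(Quotient.quot principal) D)%qT.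

End Jacobian.

Local Open Scope classical_set_scope.

(* [fset_set A] is empty when [A] is infinite, so [ncard A] is then [0]. *)
Definition ncard (T : choiceType) (A : set T) : nat := #|` fset_set A|%fset.

Section Subgroups.
Variable A : zmodType.

Definition is_subgroup (H : set A) : Prop :=
  H 0 /\ forall a b, H a -> H b -> H (a - b).

Definition generated_by (a : A) : set A := smallest is_subgroup [set a].

Definition coset (H : set A) (a : A) : set A := [set a + h | h in H].

Definition subgroup_index (H : set A) : nat := ncard [set coset H a | a in setT].

End Subgroups.

Section EdgeDeletion.
Variables (V : finType) (G : multigraph V) (x y : V) (xy : x != y) (k : int).

(* For [k = Negz n = - n.+1], deletion means addition of [n.+1] edges. *)
Definition delete_mult (v w : V) : nat :=
  if ((v == x) && (w == y)) || ((v == y) && (w == x)) then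
    match k with
    | Posz n => (G v w - n)%N
    | Negz n => (G v w + n.+1)%N
    end
  else G v w.

Lemma delete_mult_sym v w : delete_mult v w = delete_mult w v.
Proof.
by rewrite /delete_mult (mult_sym G v w) orbC [X in X || _]andbC [X in _ || X]andbC.
Qed.

Lemma delete_mult_loopless v : delete_mult v v = 0%N.
Proof.
rewrite /delete_mult; case: ifP => [|_]; last exact: mult_loopless.
by case: eqP => [->|_]; rewrite ?(negPf xy) ?andbF.
Qed.

Definition delete_edges : multigraph V :=
  Multigraph delete_mult_sym delete_mult_loopless.

End EdgeDeletion.

(* Main.v *)
(* Write delta for delta_xy. The Laplacians satisfy L1 sigma = L sigma - k (sigma_y - sigma_x) delta,
   so [Jac(G) : S] and [Jac(G1) : S1] are both the index n of im L + Z delta in Div^0; with s and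
   s1 the orders of delta in the two Jacobians, it remains to show that g = gcd(s, s1) divides n.
   If L sigma = s delta and c = sigma_y - sigma_x, then (s - k c) delta is principal on G1, so g
   divides k c, and even c since s is coprime to k. The pairing D |-> <D, sigma> mod g then
   vanishes on im L (because L is self-adjoint and g divides s) and on delta (because g divides c),
   and it is onto Z/g by minimality of s; hence g divides n. *)
From HB Require Import structures.
Require Import Defs.
From mathcomp Require Import all_boot all_order all_algebra.
From mathcomp Require Import generic_quotient ring_quotient finmap ring zify.
From mathcomp Require Import boolp classical_sets cardinality.

Set Implicit Arguments.
Unset Strict Implicit.
Unset Printing Implicit Defensive.
Import GRing.Theory Num.Theory Order.TTheory.
Local Open Scope ring_scope.
Local Open Scope classical_set_scope.

(** * Cardinalities of sets, with infinite sets counted as zero *)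

Lemma ncard_infinite (T : choiceType) (A : set T) :
  ~ finite_set A -> ncard A = 0%N.
Proof. by rewrite /ncard /fset_set => infA; case: pselect. Qed.

Lemma ncard_eq (T U : choiceType) (A : set T) (B : set U) :
  (A #= B)%card -> ncard A = ncard B.
Proof.
move=> AB; have finAB := eq_finite_set AB.
have [finB|infB] := pselect (finite_set B).
  by apply/fcard_eq => //; rewrite finAB.
by rewrite !ncard_infinite // finAB.
Qed.

Lemma ncard_image (T U : choiceType) (f : T -> U) (A : set T) :
  (forall a b, A a -> A b -> f a = f b -> a = b) -> ncard (f @` A) = ncard A.
Proof.
move=> f_inj; apply/ncard_eq/inj_card_eq => a b.
by rewrite !inE; exact: f_inj.
Qed.

Lemma ncard_finType (T : finType) : ncard [set: T] = #|T|.
Proof.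
rewrite -[RHS](card_fset_set (card_esym (@card_II #|T|))).
rewrite -[RHS](ncard_image (f := @enum_val T T)); last first.
  by move=> i j _ _; exact: enum_val_inj.
by congr ncard; apply/seteqP; split=> // a _; exists (enum_rank a); rewrite ?enum_rankK.
Qed.

(** An infinite factor makes both sides zero: a nonempty partner gives a product that projects onto
    it, and an empty partner gives the empty product. *)
Lemma ncardX (T U : choiceType) (A : set T) (B : set U) :
  ncard (A `*` B) = (ncard A * ncard B)%N.
Proof.
have [->|/set0P[a Aa]] := eqVneq A set0.
  by rewrite set0X /ncard !fset_set0 !cardfs0 mul0n.
have [->|/set0P[b Bb]] := eqVneq B set0.
  by rewrite setX0 /ncard !fset_set0 !cardfs0 muln0.
have [finA|infA] := pselect (finite_set A); last first.
  rewrite (ncard_infinite infA) ncard_infinite // => /(finite_image fst) fin.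
  by apply: infA; apply: sub_finite_set fin => c Ac; exists (c, b).
have [finB|infB] := pselect (finite_set B); last first.
  rewrite (ncard_infinite infB) muln0 ncard_infinite // => /(finite_image snd) fin.
  by apply: infB; apply: sub_finite_set fin => c Bc; exists (a, c).
rewrite [in RHS]/ncard.
rewrite [in RHS]cardfE [X in (_ * X)%N]cardfE -card_prod -[RHS]ncard_finType.
pose f (u : fset_set A * fset_set B) := (val u.1, val u.2).
rewrite -[RHS](ncard_image (f := f)); last first.
  by move=> [u v] [u' v'] _ _ [/val_inj-> /val_inj->].
congr ncard; apply/seteqP; split=> [[c d] [/= Ac Bd]|_ [[u v] _ <-]].
  have Ac' : c \in fset_set A by rewrite in_fset_set // inE.
  have Bd' : d \in fset_set B by rewrite in_fset_set // inE.
  by exists ([` Ac']%fset, [` Bd']%fset).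
have := valP u; have := valP v; rewrite !in_fset_set // !inE.
by split.
Qed.

Lemma ncard_range_periodic (T : choiceType) (f : nat -> T) (n : nat) :
  (0 < n)%N -> (forall i j, f i = f j <-> i = j %[mod n]) ->
  ncard (range f) = n.
Proof.
move=> n_gt0 f_per.
rewrite -[RHS]card_ord -ncard_finType -(ncard_image (f := fun i : 'I_n => f i)).
  congr ncard; apply/seteqP; split=> [_ [i _ <-]|_ [i _ <-]]; last by exists i.
  exists (Ordinal (ltn_pmod i n_gt0)) => //=.
  by apply/f_per; rewrite modn_mod.
by move=> i j _ _ /f_per; rewrite !modn_small // => /val_inj.
Qed.

(** * Subgroups, cosets, indices and orders of elements in abelian groups *)

Section Cosets.
Variable A : zmodType.
Implicit Types (H K : set A) (a b : A).

Lemma subgroupN H a : is_subgroup H -> H a -> H (- a).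
Proof. by move=> [H0 HB] Ha; rewrite -sub0r; apply: HB. Qed.

Lemma subgroupD H a b : is_subgroup H -> H a -> H b -> H (a + b).
Proof. by move=> sgH Ha Hb; rewrite -[b]opprK; apply: sgH.2 => //; apply: (subgroupN sgH). Qed.

Lemma subgroupMz H a (m : int) : is_subgroup H -> H a -> H (a *~ m).
Proof.
move=> sgH Ha; have Hn n : H (a *+ n).
  elim: n => [|n IHn]; first by rewrite mulr0n; apply: sgH.1.
  by rewrite mulrS; apply: (subgroupD sgH).
by case: m => n; [exact: Hn | rewrite NegzE mulrNz; exact: (subgroupN sgH (Hn _))].
Qed.

Lemma coset_mem H a b : Defs.coset H a b <-> H (b - a).
Proof.
split=> [[h Hh <-]|Hba]; first by rewrite addrC addKr.
by exists (b - a); rewrite // addrC subrK.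
Qed.

Lemma coset_eq H a b : is_subgroup H -> Defs.coset H a = Defs.coset H b <-> H (a - b).
Proof.
move=> sgH; split=> [e|Hab].
  by apply/coset_mem; rewrite -e; apply/coset_mem; rewrite subrr; apply: sgH.1.
apply/seteqP; split=> c /coset_mem Hc; apply/coset_mem.
  by rewrite -(subrKA a c); apply: (subgroupD sgH).
by rewrite -(subrKA b) -(opprB a b); apply: sgH.2.
Qed.

(* As [ncard] is [0] on infinite sets, the tower law holds without finiteness assumptions. *)
Lemma index_tower H K : is_subgroup H -> is_subgroup K -> H `<=` K ->
  subgroup_index H = (subgroup_index K * ncard (Defs.coset H @` K))%N.
Proof.
move=> sgH sgK HK; rewrite /subgroup_index -ncardX.
(* A coset [X] of [K] and a coset [Y] of [H] inside [K] give the translate of [Y] by the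
   representative of [X] picked by [xget]. Cosets are nonempty, so the default [0] is never returned
   for want of a member. *)
pose f (XY : set A * set A) : set A := [set xget 0 XY.1 + b | b in XY.2].
have rep a : K (xget 0 (Defs.coset K a) - a).
  apply/coset_mem; apply: xgetPex; exists a.
  by apply/coset_mem; rewrite subrr; apply: sgK.1.
have fE a b : f (Defs.coset K a, Defs.coset H b) =
    Defs.coset H (xget 0 (Defs.coset K a) + b).
  apply/seteqP; split=> [_ [c /coset_mem Hc <-]|c /coset_mem Hc].
    by apply/coset_mem; rewrite opprD addrACA subrr add0r.
  exists (c - xget 0 (Defs.coset K a)); last by rewrite addrC subrK.
  by apply/coset_mem; rewrite -addrA -opprD.
rewrite -(ncard_image (f := f)).
  congr ncard; apply/seteqP; split=> [_ [a _ <-]|_ [[X Y] [/= [a _ <-] [b Kb <-]] <-]].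
    exists (Defs.coset K a, Defs.coset H (a - xget 0 (Defs.coset K a))).
      split=> /=; first by exists a.
      exists (a - xget 0 (Defs.coset K a)) => //.
      by rewrite -opprB; apply: (subgroupN sgK).
    by rewrite fE addrC subrK.
  by rewrite fE; exists (xget 0 (Defs.coset K a) + b).
move=> [X Y] [X' Y'] [/= [a _ <-] [b Kb <-]] [/= [a' _ <-] [b' Kb' <-]].
rewrite !fE => /(coset_eq _ _ sgH) Hab.
have eqX : Defs.coset K a = Defs.coset K a'.
  have Kpq : K (xget 0 (Defs.coset K a) - xget 0 (Defs.coset K a')).
    rewrite -[X in K X](addrK (b - b')) -addrACA -opprD.
    by apply: sgK.2; [apply: HK | apply: sgK.2].
  rewrite -(iffRL (coset_eq _ _ sgK) (rep a)) -(iffRL (coset_eq _ _ sgK) (rep a')).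
  exact/coset_eq.
rewrite eqX; congr pair; apply/coset_eq => //.
by move: Hab; rewrite eqX opprD addrACA subrr add0r.
Qed.


Lemma ncard_coset0 K : ncard (Defs.coset [set 0] @` K) = ncard K.
Proof.
apply: ncard_image => a b _ _ /(congr1 (fun X : set A => X a)) e.
have /coset_mem : Defs.coset [set 0] b a by rewrite -e; exists 0; rewrite ?addr0.
by move=> /= /eqP; rewrite subr_eq0 => /eqP.
Qed.

(** The tower law for the trivial subgroup inside [H]; cosets of the trivial subgroup are
    singletons. *)
Lemma Lagrange H : is_subgroup H ->
  ncard [set: A] = (subgroup_index H * ncard H)%N.
Proof.
move=> sgH; rewrite -(ncard_coset0 H) -index_tower //; first last.
- by move=> _ ->; apply: sgH.1.
- by split=> // _ _ -> ->; rewrite /= subrr.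
by rewrite /subgroup_index ncard_coset0.
Qed.

Lemma generated_byE a : generated_by a = range (fun m : int => a *~ m).
Proof.
apply/seteqP; split=> [b|_ [m _ <-] H [sgH Ha]]; last first.
  by apply: subgroupMz => //; apply: Ha.
apply; split; last by move=> _ ->; exists 1.
split=> [|_ _ [m _ <-] [n _ <-]]; first by exists 0.
by exists (m - n) => //; rewrite mulrzBr.
Qed.

Lemma generated_by_subgroup a : is_subgroup (generated_by a).
Proof.
rewrite generated_byE; split=> [|_ _ [m _ <-] [n _ <-]]; first by exists 0.
by exists (m - n) => //; rewrite mulrzBr.
Qed.

(** The quotient by [H] is cyclic, generated by the class of [a], and the coset of [a *~ m]
    determines exactly [m] modulo [d]. *)
Lemma index_cyclic H a d : is_subgroup H -> (0 < d)%N ->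
  (forall m : int, H (a *~ m) <-> (d %| m)%Z) ->
  (forall b, exists m : int, H (b - a *~ m)) ->
  subgroup_index H = d.
Proof.
move=> sgH d_gt0 Ha Hgen.
have coset_per (i j : int) :
    Defs.coset H (a *~ i) = Defs.coset H (a *~ j) <-> (i = j %[mod d])%Z.
  rewrite (coset_eq _ _ sgH) -mulrzBr Ha.
  by rewrite -eqz_mod_dvd; split=> [/eqP|->].
rewrite -(ncard_range_periodic (f := fun i => Defs.coset H (a *+ i)) d_gt0).
  congr ncard; apply/seteqP; split=> [_ [b _ <-]|_ [i _ <-]]; last by exists (a *+ i).
  have [m Hm] := Hgen b; exists `|(m %% d)%Z|%N => //.
  rewrite (iffRL (coset_eq _ _ sgH) Hm) pmulrn; apply/coset_per.
  by rewrite gez0_abs ?modz_mod // modz_ge0 // lt0n_neq0.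
move=> i j; rewrite !pmulrn coset_per !modz_nat; split=> [[]//|->//].
Qed.

End Cosets.

(** Take [e] to be the least positive element: the remainder of any member modulo [e] lies in [I]
    and is smaller than [e], hence zero. *)
Lemma int_subgroup_generator (I : set int) (d : nat) :
  is_subgroup I -> (0 < d)%N -> I d ->
  exists e : nat, [/\ (0 < e)%N, I e & forall i : int, I i <-> (e %| i)%Z].
Proof.
move=> sgI d_gt0 Id.
have ex_e : exists n : nat, (0 < n)%N && `[< I n >].
  by exists d; rewrite d_gt0; apply/asboolP.
case: (ex_minnP ex_e) => e /andP[e_gt0 /asboolP Ie] e_min.
exists e; split=> // i; split=> [Ii|/dvdzP[q ->]]; last first.
  by rewrite mulrC -mulrzz; apply: subgroupMz.
have Ir : I (i %% e)%Z by rewrite /modz mulrC -mulrzz; apply: sgI.2 => //; apply: subgroupMz.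
have r_lt_e : (i %% e)%Z < e by apply: ltz_pmod.
have r_ge0 : 0 <= (i %% e)%Z by rewrite modz_ge0 // lt0n_neq0.
apply/dvdz_mod0P; case: (i %% e)%Z Ir r_lt_e r_ge0 => // -[//|r] Ir r_lt_e _.
have := e_min r.+1; rewrite /= leqNgt -ltz_nat r_lt_e => e_le.
by have /e_le : `[< I r.+1 >] by exact/asboolP.
Qed.

Lemma cyclic_order (A : zmodType) (a : A) (m : nat) : (0 < m)%N -> a *+ m = 0 ->
  exists s : nat, [/\ (0 < s)%N, ncard (generated_by a) = s &
    forall i : int, a *~ i = 0 <-> (s %| i)%Z].
Proof.
move=> m_gt0 am0.
have sgI : is_subgroup [set i : int | a *~ i = 0].
  split=> [|i j /= ai0 aj0]; first exact: mulr0z.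
  by rewrite /= mulrzBr ai0 aj0 subrr.
have [s [s_gt0 _ a_ord]] := int_subgroup_generator sgI m_gt0 am0.
exists s; split=> //.
rewrite -[RHS](ncard_range_periodic (f := fun i => a *+ i) s_gt0).
  congr ncard; rewrite generated_byE; apply/seteqP; split=> [_ [i _ <-]|_ [i _ <-]].
    exists `|(i %% s)%Z|%N => //; rewrite pmulrn gez0_abs ?modz_ge0 ?lt0n_neq0 //.
    apply/eqP; rewrite -subr_eq0 -mulrzBr; apply/eqP/a_ord => /=.
    by rewrite -eqz_mod_dvd modz_mod.
  by exists i.
move=> i j; split=> [e|e].
  suff /eqP : (i == j %[mod s])%Z by rewrite !modz_nat => -[].
  by rewrite eqz_mod_dvd; apply/a_ord; rewrite /= mulrzBr -!pmulrn e subrr.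
apply/eqP; rewrite -subr_eq0 !pmulrn -mulrzBr; apply/eqP/a_ord => /=.
by rewrite -eqz_mod_dvd !modz_nat e.
Qed.

(** Preimage along a surjection is a bijection on cosets. It lifts indices from the Jacobians to the
    common group [Div0 V]. *)
Lemma index_preimage (A B : zmodType) (f : B -> A) (H : set A) :
  {morph f : a b / a - b} -> (forall a, exists b, f b = a) -> is_subgroup H ->
  is_subgroup (f @^-1` H) /\ subgroup_index (f @^-1` H) = subgroup_index H.
Proof.
move=> fB f_surj sgH; split.
  split=> [|a b /= Ha Hb]; last by rewrite fB; apply: sgH.2.
  by rewrite /= -(subrr 0) fB subrr; apply: sgH.1.
rewrite /subgroup_index -[RHS](ncard_image (f := fun X : set A => f @^-1` X)).
  have coset_pre b : Defs.coset (f @^-1` H) b = f @^-1` Defs.coset H (f b).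
    by apply/seteqP; split=> c /coset_mem /= Hc; apply/coset_mem; rewrite /= ?fB // -fB.
  congr ncard; apply/seteqP; split=> [_ [b _ <-]|_ [_ [a _ <-] <-]].
    by rewrite coset_pre; exists (Defs.coset H (f b)) => //; exists (f b).
  by have [b <-] := f_surj a; exists b.
move=> X Y _ _ eXY; apply/seteqP; split=> a; have [b <-] := f_surj a => Xb.
  by have : (f @^-1` Y) b by rewrite -eXY.
by have : (f @^-1` X) b by rewrite eXY.
Qed.

(** * The Laplacian: self-adjointness, kernel, and behaviour under edge deletion *)

Lemma ffunMzE (V : finType) (f : {ffun V -> int}) (m : int) v :
  (f *~ m) v = f v * m.
Proof.
by case: m => n; rewrite ?NegzE ?mulrNz ?ffunE -pmulrn ffunMnE ?mulrN -mulr_natr natz.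
Qed.

Section Laplacian.
Variables (V : finType) (G : multigraph V).
Implicit Types s t : {ffun V -> int}.

Lemma laplacian_appE s v :
  laplacian_app G s v = \sum_(w : V) (G v w)%:Z * (s v - s w).
Proof.
rewrite ffunE /laplacian; under eq_bigr do rewrite mulrBl.
under [RHS]eq_bigr do rewrite mulrBr.
rewrite !sumrB -mulr_suml -(big_morph Posz PoszD erefl); congr (_ - _).
rewrite (bigD1 v) //= eqxx big1 ?addr0 // => w /negPf vw.
by rewrite eq_sym vw mul0r.
Qed.

Lemma laplacian_appZ a s :
  laplacian_app G [ffun w => a * s w] = [ffun v => a * laplacian_app G s v].
Proof.
apply/ffunP => v; rewrite !ffunE mulr_sumr; apply: eq_bigr => w _.
by rewrite ffunE mulrCA.
Qed.

Lemma laplacian_selfadjoint s t :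
  \sum_v laplacian_app G s v * t v = \sum_v laplacian_app G t v * s v.
Proof.
under eq_bigr do rewrite ffunE mulr_suml.
under [RHS]eq_bigr do rewrite ffunE mulr_suml.
rewrite exchange_big; apply: eq_bigr => v _; apply: eq_bigr => w _ /=.
rewrite /laplacian [w == v]eq_sym mult_sym; case: eqP => [->|_]; ring.
Qed.

(** Averaging over the swap of [v] and [w] turns the summand into a square. The sum over ordered
    pairs meets each edge twice, hence the factor 2. *)
Lemma laplacian_energy s :
  (\sum_v laplacian_app G s v * s v) *+ 2 =
  \sum_v \sum_w (G v w)%:Z * (s v - s w) ^+ 2.
Proof.
under eq_bigr do rewrite laplacian_appE mulr_suml.
rewrite mulr2n {2}exchange_big -big_split; apply: eq_bigr => v _ /=.
rewrite -big_split; apply: eq_bigr => w _ /=; rewrite (mult_sym G w v); ring.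
Qed.

Lemma degree_laplacian s : degree (laplacian_app G s) = 0.
Proof.
(* The degree is the pairing with the constant 1, whose Laplacian vanishes. *)
have := laplacian_selfadjoint s [ffun=> 1]; under eq_bigr do rewrite [X in _ * X]ffunE mulr1.
rewrite /degree => ->; apply: big1 => v _; rewrite laplacian_appE.
by rewrite big1 ?mul0r // => w _; rewrite !ffunE subrr mulr0.
Qed.

(** All terms of the energy are nonnegative, so each is zero and [s] agrees across every edge, hence
    along paths. *)
Lemma energy0_const s : connected_graph G ->
  \sum_v laplacian_app G s v * s v = 0 -> forall v w, s v = s w.
Proof.
move=> conG /(congr1 (fun z => z *+ 2)); rewrite laplacian_energy mul0rn => E0.
have termge0 v w : 0 <= (G v w)%:Z * (s v - s w) ^+ 2.
  by rewrite mulr_ge0 ?sqr_ge0.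
have edge v w : (0 < G v w)%N -> s v = s w.
  move=> Gvw; move/eqP: E0; rewrite psumr_eq0 => [|u _]; last exact: sumr_ge0.
  move/allP/(_ v (mem_index_enum v)); rewrite /= psumr_eq0 //.
  move/allP/(_ w (mem_index_enum w)); rewrite /= mulf_eq0 sqrf_eq0 subr_eq0.
  by rewrite eqz_nat eqn0Ngt Gvw => /eqP.
move=> v w; have /connectP[p] := conG v w.
elim: p v => [|u p IHp] v /=; first by move=> _ ->.
by move=> /andP[/edge-> +] wp => /IHp ->.
Qed.

Lemma sum_enum_val (F : V -> int) :
  \sum_(j < #|V|) F (enum_val j) = \sum_v F v.
Proof. by rewrite [RHS](reindex (@enum_val V V)) //; exact/onW_bij/enum_val_bij. Qed.

(* The Laplacian corrected by a one at the diagonal entry [x] is nonsingular, so its adjugate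
   solves the equation; summing coordinates shows that the correction vanishes on the solution. *)
Lemma laplacian_multiple (x : V) (D : divisor V) : connected_graph G -> degree D = 0 ->
  exists (m : nat) s, (0 < m)%N /\ laplacian_app G s = D *+ m.
Proof.
move=> conG D0.
pose M : 'M[int]_#|V| := \matrix_(i, j)
  (laplacian G (enum_val i) (enum_val j)
   + ((enum_val i == x) && (enum_val j == x))%:R).
have mulM (s : {ffun V -> int}) i : \sum_j M i j * s (enum_val j) =
    laplacian_app G s (enum_val i) + (enum_val i == x)%:R * s x.
  under eq_bigr do rewrite mxE mulrDl.
  rewrite big_split /= ffunE; congr (_ + _).
    exact: (sum_enum_val (fun w => laplacian G (enum_val i) w * s w)).
  rewrite (sum_enum_val (fun w => ((enum_val i == x) && (w == x))%:R * s w)).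
  rewrite (bigD1 x) //= eqxx andbT big1 ?addr0 // => w /negPf->.
  by rewrite andbF mul0r.
have detM : \det M != 0.
  (* A kernel vector vanishes at [x] because Laplacians have degree zero; its energy is then zero,
     so it is constant and hence zero. *)
  rewrite -det_tr; apply/det0P => -[v v0 vM].
  pose s : {ffun V -> int} := [ffun w => v 0 (enum_rank w)].
  have Ms w : laplacian_app G s w + (w == x)%:R * s x = 0.
    have := congr1 (fun u : 'rV_#|V| => u 0 (enum_rank w)) vM.
    rewrite !mxE => e; rewrite -[w]enum_rankK -mulM -[RHS]e.
    by apply: eq_bigr => j _; rewrite [M^T _ _]mxE mulrC ffunE enum_valK.
  have sx0 : s x = 0.
    have := degree_laplacian s; rewrite /degree.
    under eq_bigr => w _ do rewrite -[laplacian_app G s w](addrK ((w == x)%:R * s x)) Ms sub0r.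
    rewrite (bigD1 x) //= eqxx big1 => [|w /negPf->]; last by rewrite mul0r oppr0.
    by rewrite mul1r addr0 => /eqP; rewrite oppr_eq0 => /eqP.
  have s_const : forall u w, s u = s w.
    apply: energy0_const => //; apply: big1 => w _.
    by have := Ms w; rewrite sx0 mulr0 addr0 => ->; rewrite mul0r.
  case/eqP: v0; apply/rowP => j.
  by have := s_const (enum_val j) x; rewrite sx0 ffunE enum_valK mxE.
pose s : {ffun V -> int} :=
  [ffun w => \sum_j \adj M (enum_rank w) j * D (enum_val j)].
have Ms w : laplacian_app G s w + (w == x)%:R * s x = \det M * D w.
  rewrite -[w]enum_rankK -mulM.
  under eq_bigr do rewrite ffunE enum_valK mulr_sumr.
  rewrite exchange_big /=.
  under eq_bigr do under eq_bigr do rewrite mulrA.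
  under eq_bigr do rewrite -mulr_suml.
  have adjM j : \sum_i M (enum_rank w) i * \adj M i j = (\det M)%:M (enum_rank w) j.
    by rewrite -mul_mx_adj mxE.
  under eq_bigr do rewrite adjM mxE.
  rewrite (bigD1 (enum_rank w)) //= eqxx mulr1n big1 ?addr0 // => j.
  by rewrite eq_sym => /negPf->; rewrite mulr0n mul0r.
have sx0 : s x = 0.
  have := degree_laplacian s; rewrite /degree.
  under eq_bigr => w _ do rewrite -[laplacian_app G s w](addrK ((w == x)%:R * s x)) Ms.
  rewrite sumrB -mulr_sumr -/(degree D) D0 mulr0 sub0r (bigD1 x) //= eqxx.
  rewrite big1 => [|w /negPf->]; last by rewrite mul0r.
  by rewrite mul1r addr0 => /eqP; rewrite oppr_eq0 => /eqP.
(* The sign of the determinant is moved into the solution so that the multiplier is positive. *)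
exists `|\det M|%N, [ffun w => sgz (\det M) * s w]; split; first by rewrite absz_gt0.
apply/ffunP => w; rewrite laplacian_appZ ffunE ffunMnE.
have := Ms w; rewrite sx0 mulr0 addr0 => ->.
by rewrite mulrA -abszEsg -[RHS]mulr_natr natz mulrC.
Qed.

End Laplacian.

Lemma laplacian_delete (V : finType) (G : multigraph V) (x y : V) (xy : x != y)
    (k : int) (s : {ffun V -> int}) :
  (0 <= k -> k <= (G x y)%:Z) ->
  laplacian_app (delete_edges G xy k) s =
  laplacian_app G s - delta_div x y *~ (k * (s y - s x)).
Proof.
move=> kG; apply/ffunP => v; rewrite !laplacian_appE.
rewrite [RHS]ffunE [X in _ + X]ffunE ffunMzE laplacian_appE ffunE.
(* By [kG] the truncated subtraction is a true one, so one formula serves both signs of [k]. *)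
have multE w : (delete_edges G xy k v w)%:Z = (G v w)%:Z -
    k * (((v == x) && (w == y)) || ((v == y) && (w == x)))%:R.
  rewrite /= /delete_mult; case: ifP => [pair|_]; last by rewrite mulr0 subr0.
  have Gvw : G v w = G x y.
    by case/orP: pair => /andP[/eqP-> /eqP->] //; exact: mult_sym.
  by rewrite mulr1 Gvw; case: k kG => n; lia.
under eq_bigr do rewrite multE mulrBl -mulrA.
rewrite sumrB -mulr_sumr; congr (_ - _); rewrite mulrCA; congr (k * _).
have [->|vx] /= := eqVneq v x.
  rewrite (negPf xy) (bigD1 y) //= eqxx big1 ?addr0 => [|w /negPf->]; last by rewrite mul0r.
  by rewrite mul1r; ring.
have [->|vy] /= := eqVneq v y.
  rewrite (bigD1 x) //= eqxx big1 ?addr0 => [|w /negPf->]; last by rewrite mul0r.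
  by rewrite mul1r; ring.
by rewrite big1 ?subrr ?mul0r // => w _; rewrite mul0r.
Qed.

(** * Divisor classes and the pairing of divisors with integer functions *)

Section Jacobian.
Variables (V : finType) (G : multigraph V).
Implicit Types D : Div0 V.

Lemma div_class_zmod_morphism : {morph @div_class V G : D E / D - E}.
Proof. exact: raddfB. Qed.
HB.instance Definition _ :=
  GRing.isZmodMorphism.Build (Div0 V) (Jac G) (@div_class V G) div_class_zmod_morphism.

Lemma div_class_eq0 D :
  div_class G D = 0 <-> exists s, div0_val D = laplacian_app G s.
Proof.
rewrite -(raddf0 (@div_class V G)) /div_class.
split=> [/eqP|DL]; last apply/eqP.
  by rewrite -Quotient.idealrBE subr0 => /asboolP.
by rewrite -Quotient.idealrBE subr0; apply/asboolP.
Qed.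

Lemma div_class_surj (a : Jac G) : exists D, div_class G D = a.
Proof. by exists (repr a); exact: reprK. Qed.

(** If the Laplacian of [sigma] is a positive multiple [n] of a divisor [E], then [pairing sigma D]
    over [n], modulo 1, is the monodromy pairing of [E] and [D]. *)
Definition pairing (s : divisor V) (D : Div0 V) : int := \sum_v div0_val D v * s v.

Lemma pairing_zmod_morphism s : {morph pairing s : D E / D - E}.
Proof.
move=> D E; rewrite /pairing -sumrB; apply: eq_bigr => v _.
by rewrite !ffunE mulrBl.
Qed.
HB.instance Definition _ s :=
  GRing.isZmodMorphism.Build (Div0 V) int (pairing s) (pairing_zmod_morphism s).

Lemma pairing_delta s x y : pairing s (delta x y) = s y - s x.
Proof.
have sum1 z : \sum_v (v == z)%:R * s v = s z.
  by rewrite (bigD1 z) //= eqxx mul1r big1 ?addr0 // => v /negPf->; rewrite mul0r.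
rewrite /pairing; under eq_bigr do rewrite ffunE mulrBl.
by rewrite sumrB !sum1.
Qed.

Lemma div0_valMz D (m : int) : div0_val (D *~ m) = div0_val D *~ m.
Proof. exact: (raddfMz (\val : Div0 V -> divisor V)). Qed.

(** Lifts the cyclic subgroup to [Div0 V], where it becomes the principal divisors plus the
    multiples of [D]. *)
Lemma generated_by_class D E :
  generated_by (div_class G D) (div_class G E) <->
  exists (m : int) s, div0_val E = laplacian_app G s + div0_val D *~ m.
Proof.
rewrite generated_byE; split=> [[m _ e]|[m [s e]]].
  have /div_class_eq0[s es] : div_class G (E - D *~ m) = 0.
    by rewrite raddfB /= raddfMz e subrr.
  by exists m, s; rewrite -es /= div0_valMz subrK.
exists m => //; apply/eqP; rewrite eq_sym -subr_eq0 -raddfMz -raddfB; apply/eqP.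
by apply/div_class_eq0; exists s; rewrite /= div0_valMz e addrK.
Qed.

Section Order.
Variables (x y : V) (s : nat) (sigma : divisor V).
Hypotheses (s_gt0 : (0 < s)%N)
  (s_ord : forall i : int, div_class G (delta x y) *~ i = 0 <-> (s %| i)%Z)
  (Lsigma : laplacian_app G sigma = delta_div x y *~ s).

(** The values of the pairing together with [d] generate some [e] dividing [s]. Then [sigma] is
    constant modulo [e], and dividing its differences by [e] makes [s %/ e] times delta principal;
    minimality of [s] forces [e = 1]. *)
Lemma pairing_primitive (d : nat) : (0 < d)%N -> (d %| s)%N ->
  exists D, (d %| pairing sigma D - 1)%Z.
Proof.
move=> d_gt0 ds.
pose I : set int := [set i | exists D, (d %| pairing sigma D - i)%Z].
have sgI : is_subgroup I.
  split=> [|i j [D Di] [E Ej]]; first by exists 0; rewrite raddf0 subr0 dvdz0.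
  exists (D - E); rewrite raddfB /= addrAC opprB addrA.
  by have := rpredB Di Ej; rewrite opprB; congr (_ %| _)%Z; ring.
have Id : I d by exists 0; rewrite raddf0 sub0r rpredN dvdzz.
have [e [e_gt0 Ie e_dvd]] := int_subgroup_generator sgI d_gt0 Id.
suff e1 : e = 1%N by case: Ie => D; rewrite e1; exists D.
have e_s : (e %| s)%N by have /e_dvd e_d := Id; apply: dvdn_trans ds.
(* Pairing with [delta x v] shows that [sigma] is constant modulo [e], so the division defining
   [tau] is exact. *)
have e_sigma v : (e %| sigma v - sigma x)%Z.
  by apply/e_dvd; exists (delta x v); rewrite pairing_delta subrr dvdz0.
pose tau : {ffun V -> int} := [ffun v => ((sigma v - sigma x) %/ e)%Z].
have tauE : laplacian_app G [ffun v => e%:Z * tau v] = delta_div x y *~ s.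
  rewrite -Lsigma; apply/ffunP => v; rewrite !laplacian_appE.
  apply: eq_bigr => w _; rewrite !ffunE ![e%:Z * _]mulrC !divzK //.
  by rewrite opprB addrA subrK.
have : div_class G (delta x y) *~ (s %/ e)%N = 0.
  rewrite -raddfMz; apply/div_class_eq0; exists tau.
  rewrite div0_valMz; apply/ffunP => v.
  have e_neq0 : e%:Z != 0 by rewrite eqz_nat lt0n_neq0.
  apply: (mulfI e_neq0).
  move: tauE; rewrite laplacian_appZ => /ffunP/(_ v); rewrite [LHS]ffunE => ->.
  by rewrite !ffunMzE mulrCA -PoszM mulnC divnK.
move/s_ord => /dvdn_leq; rewrite divn_gt0 // => /(_ (dvdn_leq s_gt0 e_s)) le_s.
apply/eqP; rewrite eqn_leq e_gt0 andbT leqNgt; apply/negP => /ltn_Pdiv/(_ s_gt0).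
by rewrite ltnNge le_s.
Qed.

(* The pairing with [sigma] modulo [d] kills both the principal divisors and [delta x y]. *)
Lemma dvdn_index_generated_by (d : nat) : (0 < d)%N -> (d %| s)%N ->
  (d %| sigma y - sigma x)%Z ->
  (d %| subgroup_index (generated_by (div_class G (delta x y))))%N.
Proof.
move=> d_gt0 ds dsigma.
have [u du] := pairing_primitive d_gt0 ds.
have [sgH <-] := index_preimage div_class_zmod_morphism div_class_surj
  (generated_by_subgroup (div_class G (delta x y))).
pose K : set (Div0 V) := [set D | (d %| pairing sigma D)%Z].
have sgK : is_subgroup K.
  split=> [|D E KD KE]; first by rewrite /K /= raddf0 dvdz0.
  by rewrite /K /= raddfB; apply: rpredB.
rewrite (index_tower sgH sgK) => [|D /generated_by_class[m [t Dt]]].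
  (* [K] has index [d]: the pairing of [u] is 1 modulo [d], so the multiples of [u] meet every
     residue. *)
  rewrite (index_cyclic sgK d_gt0 (a := u)) ?dvdn_mulr // => [m|D].
    rewrite /K /= raddfMz -mulrzr intz.
    have -> : pairing sigma u * m = (pairing sigma u - 1) * m + m by ring.
    by rewrite rpredDl // dvdz_mulr.
  exists (pairing sigma D); rewrite /K /= raddfB raddfMz /= -mulrzr intz.
  have -> : pairing sigma D - pairing sigma u * pairing sigma D =
    - ((pairing sigma u - 1) * pairing sigma D) by ring.
  by rewrite rpredN dvdz_mulr.
have /div_class_eq0 e : exists t, div0_val (D - delta x y *~ m) = laplacian_app G t.
  by exists t; rewrite /= div0_valMz Dt addrK.
(* The multiple of delta is handled by [dsigma]. On the principal rest, self-adjointness moves the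
   Laplacian onto [sigma], leaving a multiple of [s]. *)
rewrite /K /= -[D](subrK (delta x y *~ m)) raddfD /=.
rewrite [pairing _ (delta x y *~ m)]raddfMz /= pairing_delta.
rewrite rpredD //; last by rewrite -mulrzr dvdz_mulr.
rewrite /pairing /= div0_valMz Dt addrK laplacian_selfadjoint.
apply: rpred_sum => v _.
by rewrite Lsigma ffunMzE dvdz_mulr // dvdz_mull.
Qed.

End Order.
End Jacobian.

(** * Comparison of the Jacobians before and after the change of edges *)

Section EdgeDeletion.
Variables (V : finType) (G : multigraph V) (x y : V) (xy : x != y) (k : int).
Hypothesis (kG : 0 <= k -> k <= (G x y)%:Z).
Let G1 := delete_edges G xy k.

(** The two Laplacians differ by multiples of delta, so both subgroups have the same preimage in
    [Div0 V]. *)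
Lemma index_delete_edges :
  subgroup_index (generated_by (div_class G1 (delta x y))) =
  subgroup_index (generated_by (div_class G (delta x y))).
Proof.
have index_Div0 H := (index_preimage (@div_class_zmod_morphism V H)
  (@div_class_surj V H) (generated_by_subgroup (div_class H (delta x y)))).2.
rewrite -!index_Div0; congr subgroup_index.
apply/seteqP; split=> D /generated_by_class[m [s e]]; apply/generated_by_class.
  exists (m - k * (s y - s x)), s.
  by rewrite e laplacian_delete // mulrzBr addrAC addrA.
exists (m + k * (s y - s x)), s.
by rewrite e laplacian_delete // mulrzDr [_ *~ m + _]addrC addrA subrK.
Qed.

(** The order is finite because some positive multiple of delta is principal. *)
Lemma div_class_delta_order (H : multigraph V) : connected_graph H ->
  exists s : nat, [/\ (0 < s)%N, ncard (generated_by (div_class H (delta x y))) = s &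
    forall i : int, div_class H (delta x y) *~ i = 0 <-> (s %| i)%Z].
Proof.
move=> conH.
have [|m [s [m_gt0 Ls]]] := laplacian_multiple (D := delta_div x y) x conH.
  exact/eqP/(div0P (delta x y)).
apply: (cyclic_order m_gt0); rewrite pmulrn -raddfMz.
by apply/div_class_eq0; exists s; rewrite div0_valMz -pmulrn Ls.
Qed.

Lemma gcd_card_Jac_dvd_index : connected_graph G -> connected_graph G1 ->
  gcdz (ncard [set: Jac G])%:Z k = 1 ->
  (gcdn (ncard [set: Jac G]) (ncard [set: Jac G1]) %|
   subgroup_index (generated_by (div_class G (delta x y))) ^ 2)%N.
Proof.
move=> conG conG1.
have [s [s_gt0 s_card s_ord]] := div_class_delta_order conG.
have [s1 [s1_gt0 s1_card s1_ord]] := div_class_delta_order conG1.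
rewrite (Lagrange (generated_by_subgroup (div_class G (delta x y)))) s_card.
rewrite (Lagrange (generated_by_subgroup (div_class G1 (delta x y)))) s1_card.
rewrite index_delete_edges; set n := subgroup_index _ => cop_k.
(* The two group orders are [n * s] and [n * s1], so only [gcdn s s1] dividing [n] remains. *)
rewrite -muln_gcdr expnS expn1 dvdn_mul //.
have /s_ord : (s %| s%:Z)%Z by exact: dvdzz.
rewrite -raddfMz => /div_class_eq0[sigma].
rewrite div0_valMz => /esym Lsigma.
(* The Laplacian of [G1] sends [sigma] to this multiple of delta. *)
have s1_dvd : (s1 %| s%:Z - k * (sigma y - sigma x))%Z.
  apply/s1_ord; rewrite -raddfMz; apply/div_class_eq0; exists sigma.
  by rewrite laplacian_delete // Lsigma div0_valMz mulrzBr.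
apply: (dvdn_index_generated_by s_gt0 s_ord Lsigma).
- by rewrite gcdn_gt0 s_gt0.
- exact: dvdn_gcdl.
have g_s : (gcdn s s1 %| s%:Z)%Z by exact: dvdn_gcdl.
have : (gcdn s s1 %| k * (sigma y - sigma x))%Z.
  rewrite -[X in (_ %| X)%Z](subKr s%:Z) rpredB //.
  exact: dvdz_trans (dvdn_gcdr _ _ : (gcdn s s1 %| s1%:Z)%Z) s1_dvd.
(* [k] cancels: [gcdn s s1] divides [n * s], which is coprime to [k]. *)
rewrite Gauss_dvdzr //; move/eqP: cop_k; rewrite -/(coprimez _ _) !coprimezE.
by apply: coprime_dvdl; rewrite /= dvdn_mull // dvdn_gcdl.
Qed.

End EdgeDeletion.

Theorem theorem3p5 (V : finType) (G : multigraph V) (x y : V) (xy : x != y)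
    (k : int) :
  connected_graph G ->
  ((0 <= k)%R -> (k <= (G x y)%:Z)%R) ->
  let G1 := delete_edges G xy k in
  connected_graph G1 ->
  let J := ncard [set: Jac G]%classic in
  let J1 := ncard [set: Jac G1]%classic in
  let S := generated_by (div_class G (delta x y)) in
  let S1 := generated_by (div_class G1 (delta x y)) in
  gcdz J%:Z k = 1%R ->
  (gcdn J J1 %| (subgroup_index S) ^ 2)%N /\
  (gcdn J J1 %| (subgroup_index S1) ^ 2)%N.
Proof.
move=> conG kG G1 conG1 J J1 S S1 cop_k.
rewrite /S1 index_delete_edges //.
by split; apply: gcd_card_Jac_dvd_index.
Qed.
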